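(* Let $(R,\mathfrak m)$ be a noetherian local integral domain with fraction field $Q(R)$. Then $\dim (Q(R)/R)=\dim R-1$. In particular, the $R$-module $Q(R)/R$ is artinian if and only if $\dim R=1$.
   Context: The (Krull) dimension of an $R$-module $X$, not necessarily finitely generated, is $\dim X=\sup\{\dim R/\mathfrak p : \mathfrak p\in\operatorname{Supp}_R(X)\}$.
   Formalization: The equivalence ''Q(R)/R is artinian iff dim R = 1'' is stated only for R not a field, since for a field Q(R)/R = 0 is artinian while dim R = 0; the zero module is given dimension -1, so that dim(Q(R)/R) = dim R - 1 also holds for fields. *)

(* Defs.v *)
From HB Require Import structures.
From mathcomp Require Import all_boot all_order all_algebra.
From mathcomp Require Import ring_quotient fraction generic_quotient.
From mathcomp Require Import ring zify.
From mathcomp Require Import boolp classical_sets constructive_ereal.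

Set Implicit Arguments.
Unset Strict Implicit.
Unset Printing Implicit Defensive.

Import Order.TTheory GRing.Theory Num.Theory.

Local Open Scope ring_scope.
Local Open Scope quotient_scope.

(* ACC and DCC on submodules. *)
Definition noetherian_module (A : comNzRingType) (X : lmodType A) : Prop :=
  forall N : nat -> submodClosed X,
    (forall i, {subset N i <= N i.+1}) ->
    exists n, forall i, (n <= i)%N -> N i =i N n.

Definition artinian_module (A : comNzRingType) (X : lmodType A) : Prop :=
  forall N : nat -> submodClosed X,
    (forall i, {subset N i.+1 <= N i}) ->
    exists n, forall i, (n <= i)%N -> N i =i N n.

Definition noetherian_ring (A : comNzRingType) : Prop := noetherian_module A^o.

(* An [idealr] is proper by definition. *)
Definition maximal_ideal (A : comNzRingType) (I : idealr A) : Prop :=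
  forall J : idealr A, {subset I <= J} -> J =i I.

Definition local_ring (A : comNzRingType) (m : idealr A) : Prop :=
  maximal_ideal m /\ forall n : idealr A, maximal_ideal n -> n =i m.

Section QuotientModule.
Variables (A : comNzRingType) (X : lmodType A) (N : submodClosed X).

(* [submodClosed] does not inherit from [zmodClosed], which [Quotient.quot]
   expects. *)
Fact submodule_zmod_closed : zmod_closed N.
Proof. exact: GRing.submod_closedB (GRing.submodClosedP N). Qed.

Definition subgroup : zmodClosed X :=
  HB.pack_for (zmodClosed X) (fun x => x \in N)
    (GRing.isZmodClosed.Build X (fun x => x \in N) submodule_zmod_closed).

Definition quotient_module : Type := Quotient.quot subgroup.

HB.instance Definition _ := GRing.Zmodule.on quotient_module.

Definition qscale (a : A) (x : quotient_module) : quotient_module :=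
  \pi_(Quotient.quot subgroup) (a *: (repr x : X)).

Lemma qscale_pi a (x : X) :
  qscale a (\pi_(Quotient.quot subgroup) x) = \pi_(Quotient.quot subgroup) (a *: x).
Proof.
rewrite /qscale; apply/eqP; rewrite -Quotient.idealrBE -scalerBr.
apply: (@rpredZ _ _ N); change (repr (\pi_(Quotient.quot subgroup) x) - x \in subgroup).
by rewrite Quotient.idealrBE reprK.
Qed.

Lemma qscaleA a b x : qscale a (qscale b x) = qscale (a * b) x.
Proof.
by elim/(@quotW _ (Quotient.quot subgroup)): x => x; rewrite !qscale_pi scalerA.
Qed.

Lemma qscale1 : left_id 1 qscale.
Proof.
by elim/(@quotW _ (Quotient.quot subgroup)) => x; rewrite qscale_pi scale1r.
Qed.

Lemma qscaleDr : right_distributive qscale +%R.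
Proof.
move=> a; elim/(@quotW _ (Quotient.quot subgroup)) => x.
elim/(@quotW _ (Quotient.quot subgroup)) => y.
by rewrite -[LHS]/(qscale a (_ + _)) -raddfD !qscale_pi scalerDr raddfD.
Qed.

Lemma qscaleDl x : {morph qscale^~ x : a b / a + b}.
Proof.
move=> a b; elim/(@quotW _ (Quotient.quot subgroup)): x => x.
by rewrite /= !qscale_pi scalerDl raddfD.
Qed.

HB.instance Definition _ := GRing.Zmodule_isLmodule.Build A quotient_module
  qscaleA qscale1 qscaleDr qscaleDl.

End QuotientModule.

Section FractionModule.
Variable R : idomainType.

Definition fraction_module : Type := {fraction R}.

HB.instance Definition _ := GRing.Zmodule.on fraction_module.

Definition fscale (a : R) (x : fraction_module) : fraction_module :=
  (FracField.tofrac a * x : {fraction R}).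

Lemma fscaleA a b x : fscale a (fscale b x) = fscale (a * b) x.
Proof. by rewrite /fscale tofracM mulrA. Qed.

Lemma fscale1 : left_id 1 fscale.
Proof. by move=> x; rewrite /fscale tofrac1 mul1r. Qed.

Lemma fscaleDr : right_distributive fscale +%R.
Proof. by move=> a x y; rewrite /fscale [LHS]mulrDr. Qed.

Lemma fscaleDl x : {morph fscale^~ x : a b / a + b}.
Proof. by move=> a b; rewrite /fscale /= tofracD [LHS]mulrDl. Qed.

HB.instance Definition _ := GRing.Zmodule_isLmodule.Build R fraction_module
  fscaleA fscale1 fscaleDr fscaleDl.

Definition base_submodule (x : fraction_module) : bool :=
  `[< exists a : R, x = FracField.tofrac a >].

Lemma base_submodule_closed : submod_closed base_submodule.
Proof.
split; first by apply/asboolP; exists 0; rewrite tofrac0.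
move=> a x y /asboolP[b ->] /asboolP[c ->]; apply/asboolP; exists (a * b + c).
by rewrite tofracD tofracM.
Qed.

HB.instance Definition _ :=
  GRing.isSubmodClosed.Build R fraction_module base_submodule
    base_submodule_closed.

(* Q(R) / R *)
Definition fraction_quotient : lmodType R :=
  quotient_module (GRing.SubmodClosed.clone R fraction_module base_submodule _).

End FractionModule.

(* The localization X_p, as an abelian group: fractions x / s with s \notin p,
   where x / s = y / t iff u (t x - s y) = 0 for some u \notin p. *)
Section Localization.
Variables (A : comNzRingType) (p : prime_idealr A) (X : lmodType A).

Definition denominator : Type := {s : A | s \notin p}.
HB.instance Definition _ := Choice.on denominator.
Implicit Types (x y z : X) (s t u : denominator) (f g h : X * denominator).

Fact denominator1_subproof : 1 \notin p.
Proof. by rewrite idealr1. Qed.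

Definition denominator1 : denominator := exist _ 1 denominator1_subproof.

Fact denominatorM_subproof s t : sval s * sval t \notin p.
Proof. by rewrite prime_idealrM negb_or (valP s) (valP t). Qed.

Definition denominatorM s t : denominator :=
  exist _ (sval s * sval t) (denominatorM_subproof s t).

Definition loc_equiv f g : bool :=
  `[< exists u, sval u *: (sval g.2 *: f.1 - sval f.2 *: g.1) = 0 >].

Lemma loc_equivP f g :
  reflect (exists u, (sval u * sval g.2) *: f.1 = (sval u * sval f.2) *: g.1)
          (loc_equiv f g).
Proof.
apply: (iffP (asboolP _)) => -[u e]; exists u.
  by apply/eqP; rewrite -!scalerA -subr_eq0 -scalerBr e.
by rewrite scalerBr !scalerA e subrr.
Qed.

Lemma loc_equiv_is_equiv : equiv_class_of loc_equiv.
Proof.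
have sym f g : loc_equiv f g -> loc_equiv g f.
  by move=> /loc_equivP[u e]; apply/loc_equivP; exists u.
split=> [f|f g|g f h].
- by apply/loc_equivP; exists denominator1.
- by apply/idP/idP; apply: sym.
move=> /loc_equivP[u eu] /loc_equivP[v ev]; apply/loc_equivP.
exists (denominatorM (denominatorM u v) g.2) => /=.
transitivity ((sval v * sval h.2) *: ((sval u * sval g.2) *: f.1)).
  by rewrite scalerA; congr (_ *: _); ring.
rewrite eu scalerA.
transitivity ((sval u * sval f.2) *: ((sval v * sval h.2) *: g.1)).
  by rewrite scalerA; congr (_ *: _); ring.
by rewrite ev scalerA; congr (_ *: _); ring.
Qed.

Canonical loc_equiv_equiv := EquivRelPack loc_equiv_is_equiv.
Canonical loc_equiv_encModRel := defaultEncModRel loc_equiv.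

Definition localized_module : Type := {eq_quot loc_equiv}.
HB.instance Definition _ : EqQuotient _ loc_equiv localized_module :=
  EqQuotient.on localized_module.
HB.instance Definition _ := Choice.on localized_module.

Definition loc_add_rep f g : X * denominator :=
  (sval g.2 *: f.1 + sval f.2 *: g.1, denominatorM f.2 g.2).
Definition loc_opp_rep f : X * denominator := (- f.1, f.2).

Definition loc_zero : localized_module :=
  lift_cst localized_module (0 : X, denominator1).
Definition loc_add := lift_op2 localized_module loc_add_rep.
Definition loc_opp := lift_op1 localized_module loc_opp_rep.

Canonical loc_zero_morph := PiConst loc_zero.

Lemma loc_pi_add : {morph \pi : f g / loc_add_rep f g >-> loc_add f g}.
Proof.
move=> f g; unlock loc_add; apply/eqmodP => /=.
have /eqmodP/loc_equivP[u eu] : f = repr (\pi_localized_module f)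
  %[mod localized_module] by rewrite reprK.
have /eqmodP/loc_equivP[v ev] : g = repr (\pi_localized_module g)
  %[mod localized_module] by rewrite reprK.
move: (repr (\pi f)) (repr (\pi g)) eu ev => f' g' eu ev.
apply/loc_equivP; exists (denominatorM u v) => /=.
rewrite !scalerDr !scalerA; congr (_ + _).
  transitivity ((sval v * sval g'.2 * sval g.2) *: ((sval u * sval f'.2) *: f.1)).
    by rewrite scalerA; congr (_ *: _); ring.
  by rewrite eu scalerA; congr (_ *: _); ring.
transitivity ((sval u * sval f'.2 * sval f.2) *: ((sval v * sval g'.2) *: g.1)).
  by rewrite scalerA; congr (_ *: _); ring.
by rewrite ev scalerA; congr (_ *: _); ring.
Qed.
Canonical loc_add_morph := PiMorph2 loc_pi_add.

Lemma loc_pi_opp : {morph \pi : f / loc_opp_rep f >-> loc_opp f}.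
Proof.
move=> f; unlock loc_opp; apply/eqmodP => /=.
have /eqmodP/loc_equivP[u eu] : f = repr (\pi_localized_module f)
  %[mod localized_module] by rewrite reprK.
by apply/loc_equivP; exists u => /=; rewrite !scalerN eu.
Qed.
Canonical loc_opp_morph := PiMorph1 loc_pi_opp.

Lemma loc_addA : associative loc_add.
Proof.
move=> f g h; rewrite -[f]reprK -[g]reprK -[h]reprK !piE /loc_add_rep /=.
apply/eqmodP/loc_equivP; exists denominator1 => /=.
rewrite !scalerDr !scalerA -!addrA; congr (_ *: _ + (_ *: _ + _ *: _)); ring.
Qed.

Lemma loc_addC : commutative loc_add.
Proof.
move=> f g; rewrite -[f]reprK -[g]reprK !piE /loc_add_rep /=.
apply/eqmodP/loc_equivP; exists denominator1 => /=.
rewrite !scalerDr !scalerA addrC; congr (_ *: _ + _ *: _); ring.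
Qed.

Lemma loc_add0 : left_id loc_zero loc_add.
Proof.
move=> f; rewrite -[f]reprK !piE /loc_add_rep /=.
apply/eqmodP/loc_equivP; exists denominator1 => /=.
by rewrite scaler0 scale1r add0r !mul1r.
Qed.

Lemma loc_addN : left_inverse loc_zero loc_opp loc_add.
Proof.
move=> f; rewrite -[f]reprK !piE /loc_add_rep /loc_opp_rep /=.
apply/eqmodP/loc_equivP; exists denominator1 => /=.
by rewrite scalerN addNr !scaler0.
Qed.

HB.instance Definition _ := GRing.isZmodule.Build localized_module
  loc_addA loc_addC loc_add0 loc_addN.

End Localization.

Definition module_support (A : comNzRingType) (X : lmodType A) (p : prime_idealr A) :
    Prop :=
  exists f : localized_module p X, f != 0.

(* Every set of extended integers has a supremum, so [supremum] below never
   falls back on its default value for a nonempty set. *)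
Lemma ereal_int_supremums (S : set (\bar int)) : (supremums S !=set0)%classic.
Proof.
have [[N SN]|noub] := pselect (exists N : int, ubound S N%:E); last first.
  exists +oo%E; split=> [x _|y yub]; first exact: leey.
  case: y yub => [r|//|] yub; first by case: noub; exists r.
  by case: noub; exists 0 => x /yub; rewrite leeNy_eq => /eqP ->; rewrite leNye.
have [[z Sz]|nofin] := pselect (exists z : int, S z%:E); last first.
  exists -oo%E; split=> [x Sx|y _]; last exact: leNye.
  case: x Sx => [r Sr||//]; first by case: nofin; exists r.
  by move=> /SN; rewrite leye_eq.
pose P k := `[< S (N - k%:Z)%:E >].
have exP : exists k, P k.
  exists `|N - z|%N; apply/asboolP.
  have := SN _ Sz; rewrite lee_fin => zN.
  by rewrite gez0_abs ?subr_ge0// opprB addrCA subrr addr0.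
case: (ex_minnP exP) => k /asboolP Sk mink.
exists (N - k%:Z)%:E; split=> [x Sx|y]; last exact.
case: x Sx => [r Sr||_]; last exact: leNye; last by move=> /SN; rewrite leye_eq.
rewrite lee_fin; have := SN _ Sr; rewrite lee_fin => rN.
have := mink `|N - r|%N; rewrite /P gez0_abs ?subr_ge0// opprB addrCA subrr addr0.
move=> /(_ (asboolT Sr)); lia.
Qed.

(* Dimensions take values in {-1, 0, 1, ..., +oo}, where sup set0 = -1; in
   particular the zero module has dimension -1. *)
Definition dim_sup (S : set (\bar int)) : \bar int := supremum (-1)%E S.

(* there is a chain p 0 < p 1 < ... < p n of prime ideals of A *)
Definition has_prime_chain (A : comNzRingType) (n : nat) : Prop :=
  exists p : nat -> prime_idealr A, forall i, (i < n)%N ->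
    {subset p i <= p i.+1} /\ ~ {subset p i.+1 <= p i}.

Definition ring_dim (A : comNzRingType) : \bar int :=
  dim_sup [set n%:Z%:E | n in [set n | has_prime_chain A n]]%classic.

Definition module_dim (A : comNzRingType) (X : lmodType A) : \bar int :=
  dim_sup [set d | exists2 p : prime_idealr A,
                     module_support X p & d = ring_dim {ideal_quot p}]%classic.

(* Main.v *)
(* The support of Q(R)/R consists of the nonzero primes, so its dimension is
   computed by chains of primes with the bottom (zero) ideal removed.

   If Q(R)/R is artinian, then for 0 <> c in a prime p and b outside p the
   submodules generated by b^n / c stabilise, which makes b invertible mod p:
   nonzero primes are maximal.  Conversely, in dimension 1 the ring R/bR is
   artinian for b <> 0, so by locality any nonunit x <> 0 has a power in bR.
   Hence Q(R)/R is x-power torsion, and its x-torsion, isomorphic to R/xR,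
   satisfies DCC; for an x-power torsion module X this forces X artinian. *)
Require Import Defs.
From HB Require Import structures.
From mathcomp Require Import all_boot all_order all_algebra.
From mathcomp Require Import ring_quotient fraction generic_quotient.
From mathcomp Require Import ring zify.
From mathcomp Require Import boolp classical_sets constructive_ereal.

Set Implicit Arguments.
Unset Strict Implicit.
Unset Printing Implicit Defensive.

Import Order.TTheory GRing.Theory Num.Theory.

Local Open Scope classical_set_scope.
Local Open Scope ring_scope.
Local Open Scope quotient_scope.

(** * Submodules as sets, and descending chain conditions *)

Section Submodules.
Variables (A : comNzRingType) (X : lmodType A).
Implicit Types (S T : set X) (N : nat -> set X) (P : set (set X)).

(** Submodules are handled as bare sets, so that extensionality turns stabilisation of a chain into
    an equality and new submodules can be given by comprehension. *)
Definition submodule S : Prop :=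
  S 0 /\ forall a u v, S u -> S v -> S (a *: u + v).

Lemma submoduleD S u v : submodule S -> S u -> S v -> S (u + v).
Proof. by move=> [_ SD] Su Sv; rewrite -[u]scale1r; apply: SD. Qed.

Lemma submoduleZ S a u : submodule S -> S u -> S (a *: u).
Proof. by move=> [S0 SD] Su; rewrite -[_ *: _]addr0; apply: SD. Qed.

Lemma submoduleB S u v : submodule S -> S u -> S v -> S (u - v).
Proof.
by move=> SS Su Sv; apply: submoduleD => //; rewrite -scaleN1r; apply: submoduleZ.
Qed.

Lemma submodule_closed S : submodule S -> submod_closed (fun x => `[< S x >]).
Proof.
move=> [S0 SD]; split; first exact/asboolP.
by move=> a u v /asboolP Su /asboolP Sv; apply/asboolP; apply: SD.
Qed.

Definition submod_of S (SS : submodule S) : submodClosed X :=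
  HB.pack_for (submodClosed X) (fun x => `[< S x >])
    (GRing.isSubmodClosed.Build A X (fun x => `[< S x >]) (submodule_closed SS)).

Lemma submod_ofP S (SS : submodule S) x : reflect (S x) (x \in submod_of SS).
Proof. exact: asboolP. Qed.

Lemma submodule_mem (N : submodClosed X) : submodule [set x | x \in N].
Proof.
split=> [|a u v /= Nu Nv]; first exact: (@rpred0 _ N).
by apply: (@rpredD _ N) => //; apply: (@rpredZ _ _ N).
Qed.

(** Without a maximal member, choice picks a strictly larger member above each one, and iterating
    this gives an ascending chain that never stabilises. *)
Lemma noetherian_maximal P : noetherian_module X ->
    P `<=` submodule -> P !=set0 ->
  exists2 M, P M & forall S, P S -> M `<=` S -> S = M.
Proof.
move=> noeth Psub [M0 PM0]; apply: contrapT => nomax.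
have step (M : {M | P M}) : {M' : {M | P M} | sval M `<=` sval M' /\ sval M' <> sval M}.
  apply: cid; apply: contrapT => nex; apply: nomax.
  exists (sval M) => [|S PS MS]; first exact: svalP.
  by apply: contrapT => neq; apply: nex; exists (exist _ S PS).
pose M i := iter i (fun M => sval (step M)) (exist _ M0 PM0).
pose N i := submod_of (Psub _ (svalP (M i))).
have [i x|n Nn] := noeth N.
  by move=> /submod_ofP Mx; apply/submod_ofP; apply: (svalP (step (M i))).1.
have := (svalP (step (M n))).2; apply; apply/seteqP; split=> x Mx.
  apply/(submod_ofP (Psub _ (svalP (M n)))).
  by rewrite -[_ \in _](Nn n.+1 (leqnSn n)); apply/submod_ofP.
exact: (svalP (step (M n))).1.
Qed.

Lemma nonincreasing_le N i j : (forall k, N k.+1 `<=` N k) -> (i <= j)%N -> N j `<=` N i.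
Proof.
move=> dN /subnK <-; elim: (j - i)%N => [//|k IH] x.
by rewrite addSn => /dN; apply: IH.
Qed.

(** The condition is relative to a family [P]. Taking the ideals above [I] gives DCC for [A/I], and
    the submodules inside the [x]-torsion give DCC for that torsion, with no new module to build. *)
Definition dcc P : Prop := forall N,
  (forall i, submodule (N i)) -> (forall i, P (N i)) -> (forall i, N i.+1 `<=` N i) ->
  exists n, forall i, (n <= i)%N -> N i = N n.

Lemma artinian_dcc : artinian_module X <-> dcc setT.
Proof.
split=> [art N SN _ dN|dccX N dN].
  have [i x|n Nn] := art (fun i => submod_of (SN i)).
    by move=> /submod_ofP ?; apply/submod_ofP; apply: dN.
  exists n => i ni; apply/seteqP; split=> x Nx.
    by apply/(submod_ofP (SN n)); rewrite -(Nn i ni); apply/submod_ofP.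
  by apply/(submod_ofP (SN i)); rewrite (Nn i ni); apply/submod_ofP.
have [i|//|i x|n Nn] := dccX (fun i => [set x | x \in N i]).
- exact: submodule_mem.
- exact: dN.
exists n => i ni x.
by have /seteqP[s1 s2] := Nn i ni; apply/idP/idP; [apply: s1|apply: s2].
Qed.

(** The bound [k] is uniform in [n]: the diagonal settles all large [i] and [n] at once, which
    leaves finitely many values of [n], each with its own bound. *)
Lemma dcc_double P (S : nat -> nat -> set X) : dcc P ->
    (forall i n, submodule (S i n)) -> (forall i n, P (S i n)) ->
    (forall i n, S i.+1 n `<=` S i n) -> (forall i n, S i n.+1 `<=` S i n) ->
  exists k, forall i n, (k <= i)%N -> S i n = S k n.
Proof.
move=> dccP sS PS dS1 dS2.
have mono i j n l : (i <= j)%N -> (n <= l)%N -> S j l `<=` S i n.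
  move=> ij nl x Sx; apply: (@nonincreasing_le (fun k => S k n) i j) => //.
  exact: (@nonincreasing_le (S j) n l).
have [//|//|i x /dS1/dS2//|k0 Sk0] := dccP (fun i => S i i).
(* [S i n] is squeezed between the diagonal terms at [k0] and at [maxn i n]. *)
have corner i n : (k0 <= i)%N -> (k0 <= n)%N -> S i n = S k0 k0.
  move=> ki kn; apply/seteqP; split; first exact: mono.
  rewrite -(Sk0 (maxn i n)) ?leq_max ?ki//.
  by apply: mono; rewrite leq_max leqnn ?orbT.
have /choice[k Sk] n : exists k, forall i, (k <= i)%N -> S i n = S k n.
  by apply: dccP (fun i => S i n) _ _ _.
exists (maxn k0 (\max_(n < k0) k n)) => i n; rewrite geq_max => /andP[ki].
move=> /bigmax_leqP kni; have [k0n|nk0] := leqP k0 n.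
  by rewrite !corner ?leq_max ?leqnn.
rewrite (Sk n i) ?(kni (Ordinal nk0))//; apply/esym; apply: Sk.
by rewrite leq_max (leq_bigmax (Ordinal nk0)) orbT.
Qed.

Lemma torsion_dcc (x : A) : dcc [set N | N `<=` [set y | x *: y = 0]] ->
  (forall y : X, exists n, x ^+ n *: y = 0) -> dcc setT.
Proof.
move=> dccx tors N SN _ dN.
(* The image in [X[x]] of the [x^(n+1)]-torsion of [N i] is nonincreasing in
   both indices. *)
pose S i n := [set x ^+ n *: y | y in [set y | N i y /\ x ^+ n.+1 *: y = 0]].
have [i n|i n _ [y [_ yx] <-]|i n _ [y [Ny yx] <-]|i n _ [y [Ny yx] <-]|k Sk] :=
  dcc_double (S := S) dccx.
- split=> [|a _ _ [u [Nu ux] <-] [v [Nv vx] <-]].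
    by exists 0; rewrite ?scaler0//; split; [apply: (SN i).1|rewrite scaler0].
  exists (a *: u + v); last by rewrite scalerDr !scalerA mulrC.
  split; first exact: (SN i).2.
  by rewrite scalerDr scalerA mulrC -scalerA ux vx scaler0 addr0.
- by rewrite /= scalerA -exprS.
- by exists y => //; split=> //; apply: dN.
- exists (x *: y); last by rewrite scalerA -exprSr.
  by split; [apply: submoduleZ|rewrite scalerA -exprSr].
exists k => i ki; apply/seteqP; split; first exact: nonincreasing_le.
(* Since [k] does not depend on [n], induction applies: if [x^(n+1)] kills [y], some [z] in [N i]
   has [x^n z = x^n y], and [y - z] is killed by [x^n]. *)
have kill n : forall y, x ^+ n *: y = 0 -> N k y -> N i y.
  elim: n => [|n IH] y yx Ny.
    by move: yx; rewrite expr0 scale1r => ->; apply: (SN i).1.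
  have [z [Nz zx] zy] : S i n (x ^+ n *: y) by rewrite Sk//; exists y.
  rewrite -(subrK z y); apply: submoduleD => //; apply: IH.
    by rewrite scalerBr zy subrr.
  by apply: submoduleB => //; apply: nonincreasing_le Nz.
by move=> y; have [n] := tors y; apply: kill.
Qed.

End Submodules.

(** * Ideals, primes, and the chain condition above an ideal *)

Section Ideals.
Variable A : comNzRingType.
Implicit Types (I J : set A).

Definition ideal I : Prop := submodule (X := A^o) I.

Lemma idealD I u v : ideal I -> I u -> I v -> I (u + v).
Proof. exact: (@submoduleD A A^o). Qed.

Lemma idealB I u v : ideal I -> I u -> I v -> I (u - v).
Proof. exact: (@submoduleB A A^o). Qed.

Lemma idealMl I a u : ideal I -> I u -> I (a * u).
Proof. exact: (@submoduleZ A A^o). Qed.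

Definition ideal_add I b : set A := [set u | exists2 v, I v & exists r, u = v + r * b].

Definition ideal_colon I b : set A := [set r | I (r * b)].

Lemma ideal_addP I b : ideal I -> ideal (ideal_add I b).
Proof.
move=> Ii; split; first by exists 0; [exact: Ii.1|exists 0; rewrite mul0r addr0].
move=> a _ _ [u Iu [r ->]] [v Iv [s ->]].
exists (a * u + v); first exact: Ii.2.
by exists (a * r + s); rewrite /GRing.scale/=; ring.
Qed.

Lemma ideal_add_sub I b : I `<=` ideal_add I b.
Proof. by move=> u Iu; exists u => //; exists 0; rewrite mul0r addr0. Qed.

Lemma ideal_add_mem I b : ideal I -> ideal_add I b b.
Proof. by move=> Ii; exists 0; [exact: Ii.1|exists 1; rewrite mul1r add0r]. Qed.

Lemma ideal_colonP I b : ideal I -> ideal (ideal_colon I b).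
Proof.
move=> Ii; split; first by rewrite /ideal_colon/= mul0r; apply: Ii.1.
move=> a u v Iu Iv; rewrite /ideal_colon/= mulrDl; apply: idealD => //.
by rewrite -mulrA; apply: idealMl.
Qed.

Lemma ideal_principal b : ideal [set u | exists r, u = r * b].
Proof.
split; first by exists 0; rewrite mul0r.
by move=> a _ _ [r ->] [s ->]; exists (a * r + s); rewrite /GRing.scale/=; ring.
Qed.

Lemma ideal_idealr_closed I :
  ideal I -> ~ I 1 -> idealr_closed (fun x => `[< I x >]).
Proof.
move=> Ii I1; split; [exact/asboolP/Ii.1|exact/asboolP|].
by move=> a u v /asboolP Iu /asboolP Iv; apply/asboolP; apply: Ii.2.
Qed.

Definition idealr_of I (Ii : ideal I) (I1 : ~ I 1) : idealr A :=
  HB.pack_for (idealr A) (fun x => `[< I x >])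
    (isIdealr.Build A (fun x => `[< I x >]) (ideal_idealr_closed Ii I1)).

Definition prime_ideal I : Prop :=
  [/\ ideal I, ~ I 1 & forall a b, I (a * b) -> I a \/ I b].

Lemma prime_ideal_closed I :
  prime_ideal I -> prime_idealr_closed (fun x => `[< I x >]).
Proof.
move=> [_ _ Ip] a b /asboolP/Ip ab.
by apply/orP; case: ab => ?; [left|right]; apply/asboolP.
Qed.

Definition prime_of I (Ip : prime_ideal I) : prime_idealr A :=
  let: And3 Ii I1 _ := Ip in
  HB.pack_for (prime_idealr A) (fun x => `[< I x >])
    (isIdealr.Build A (fun x => `[< I x >]) (ideal_idealr_closed Ii I1))
    (isPrimeIdealrClosed.Build A (fun x => `[< I x >]) (prime_ideal_closed Ip)).

Lemma prime_ofP I (Ip : prime_ideal I) x : reflect (I x) (x \in prime_of Ip).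
Proof. by case: Ip => Ii I1 Ip; apply: asboolP. Qed.

Lemma idealr_ideal (I : idealr A) : ideal [set x | x \in I].
Proof.
split=> [|a u v /= Iu Iv]; first exact: idealr0.
by apply: (@rpredD _ I) => //; apply: idealMr.
Qed.

Lemma noetherian_maximal_ideal I : noetherian_ring A -> ideal I -> ~ I 1 ->
  exists M, [/\ prime_ideal M, I `<=` M &
                forall J, ideal J -> ~ J 1 -> M `<=` J -> J = M].
Proof.
move=> noeth Ii I1.
pose P := [set J | [/\ ideal J, ~ J 1 & I `<=` J]].
have [_ []//||M [Mi M1 IM] Mmax] := @noetherian_maximal A A^o P noeth.
  by exists I; split.
have max J : ideal J -> ~ J 1 -> M `<=` J -> J = M.
  by move=> Ji J1 MJ; apply: Mmax => //; split=> // u /IM /MJ.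
exists M; split=> //; split=> // a b Mab; apply: contrapT => /not_orP[Ma Mb].
(* If [1 = u + r a] with [u] in [M], then [b = u b + r a b] is in [M]. Otherwise [M + aA] is proper,
   so it equals [M] and [a] is in [M]. *)
have [[u Mu [r e]]|add1] := pselect (ideal_add M a 1).
  apply: Mb; rewrite -[b]mul1r e mulrDl -mulrA [u * b]mulrC.
  by apply: idealD => //; apply: idealMl.
apply: Ma; rewrite -(max _ (ideal_addP a Mi) add1); last exact: ideal_add_sub.
exact: ideal_add_mem.
Qed.

(** This says that [A/p] is a field, that is, that [p] is maximal. *)
Definition invertible_mod (p : prime_idealr A) : Prop :=
  forall b, b \notin p -> exists r, 1 - r * b \in p.

(* An ideal maximal among those above which DCC fails would be prime, since
   [A/(M+aA)] and [A/(M:a)] would satisfy DCC for [ab] in [M]; but then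
   [A/M] would be a field. *)
Lemma dcc_ideals_above I : noetherian_ring A -> ideal I ->
    (forall p : prime_idealr A, (forall x, I x -> x \in p) -> invertible_mod p) ->
  dcc (X := A^o) [set J | I `<=` J].
Proof.
move=> noeth Ii inv; apply: contrapT => ndcc.
pose P := [set J | [/\ ideal J, I `<=` J & ~ dcc (X := A^o) [set K | J `<=` K]]].
have [_ []//||M [Mi IM Mdcc] Mmax] := @noetherian_maximal A A^o P noeth.
  by exists I; split.
have dccM J : ideal J -> M `<=` J -> J <> M -> dcc (X := A^o) [set K | J `<=` K].
  move=> Ji MJ JM; apply: contrapT => nd; apply: JM; apply: Mmax => //.
  by split=> // u /IM /MJ.
have unitE (J : set A) : ideal J -> J 1 -> J = setT.
  by move=> Ji J1; apply/seteqP; split=> // u _; rewrite -[u]mulr1; apply: idealMl.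
suff Mp : prime_ideal M.
  have invM : invertible_mod (prime_of Mp).
    by apply: inv => x /IM Mx; apply/prime_ofP.
  apply: Mdcc => N SN MN' dN; have MN i : M `<=` N i := MN' i.
  have [N1|/existsNP[n Nn1]] := pselect (forall i, N i 1).
    by exists 0%N => i _; rewrite (unitE _ (SN i) (N1 i)) (unitE _ (SN 0%N) (N1 0%N)).
  (* Since [A/M] is a field, an element of [N i] outside [M] would put [1] into [N i], hence into
     [N n]. *)
  have NM i : (n <= i)%N -> N i = M.
    move=> ni; apply/seteqP; split; last exact: MN.
    move=> y Ny; apply: contrapT => My.
    have [|r /prime_ofP Mr] := invM y; first by apply/prime_ofP.
    apply: Nn1; apply: (nonincreasing_le dN ni); rewrite -(subrK (r * y) 1).
    by apply: idealD; [exact: SN|exact: MN Mr|apply: idealMl; rewrite //; exact: SN].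
  by exists n => i ni; rewrite !NM.
split=> // [M1|a b Mab].
  apply: Mdcc => N SN MN _; exists 0%N => i _.
  by rewrite (unitE _ (SN i) (MN i _ M1)) (unitE _ (SN 0%N) (MN 0%N _ M1)).
apply: contrapT => /not_orP[Ma Mb]; apply: Mdcc => N SN MN' dN; have MN i : M `<=` N i := MN' i.
(* [M + aA] is strictly larger than [M] because it contains [a]; below, [(M : a)] is strictly larger
   because it contains [b]. So both chains obtained from [N] stabilise. *)
have [|||i|i u /= [v Mv [r ->]]|i u [v Nv [r ->]]|n1 N1] :=
    dccM (ideal_add M a) _ _ _ (fun i => ideal_add (N i) a).
- exact: ideal_addP.
- exact: ideal_add_sub.
- by move=> e; apply: Ma; rewrite -e; apply: ideal_add_mem.
- by apply: ideal_addP; apply: SN.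
- by exists v; [apply: MN|exists r].
- by exists v; [apply: dN|exists r].
have [|||i|i u|i u|n2 N2] :=
    dccM (ideal_colon M a) _ _ _ (fun i => ideal_colon (N i) a).
- exact: ideal_colonP.
- by move=> u Mu; rewrite /ideal_colon/= mulrC; apply: idealMl.
- by move=> e; apply: Mb; rewrite -e /ideal_colon/= mulrC.
- by apply: ideal_colonP; apply: SN.
- exact: MN.
- exact: dN.
exists (maxn n1 n2) => i; rewrite geq_max => /andP[n1i n2i].
apply/seteqP; split; first by apply: nonincreasing_le; rewrite // geq_max n1i.
move=> y Ny.
(* Write [y = v + r a] with [v] in [N i]. Then [r a = y - v] lies in the earlier term, so [r] lies
   in its colon ideal, which equals that of [N i]; hence [r a] and [y] are in [N i]. *)
have [v Nv [r e]] : ideal_add (N i) a y.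
  rewrite N1// -(N1 (maxn n1 n2)) ?leq_maxl//; exact: ideal_add_sub.
have Nr : ideal_colon (N i) a r.
  rewrite N2// -(N2 (maxn n1 n2)) ?leq_maxr// /ideal_colon/=.
  rewrite (_ : r * a = y - v); last by rewrite e; ring.
  apply: idealB => //; first exact: SN.
  by apply: (nonincreasing_le dN _ Nv); rewrite geq_max n1i.
by rewrite e; exact: (idealD (SN i) Nv Nr).
Qed.

End Ideals.

(** * Correspondence between primes of [A/p] and primes above [p] *)

Section PrimesOfQuotient.
Variables (A : comNzRingType) (p : prime_idealr A).
Local Notation Ap := {ideal_quot p}.

Lemma ideal_quot_pi0 (x : A) : (\pi_Ap x == 0 :> Ap) = (x \in p).
Proof. by rewrite -[0]pi_zeror -Quotient.idealrBE subr0. Qed.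

Lemma preimage_prime (q : prime_idealr Ap) : prime_ideal [set x | \pi_Ap x \in q].
Proof.
split=> [||a b /=].
- split=> [|a u v /= qu qv]; first by rewrite /= raddf0 idealr0.
  by rewrite raddfD [X in X + _]rmorphM; apply: (@rpredD _ q); rewrite ?idealMr.
- by rewrite /= rmorph1 idealr1.
by rewrite rmorphM prime_idealrM => /orP.
Qed.

(** Representatives of one class differ by an element of [p], so the image of [q] can be described
    through [repr]. *)
Lemma image_repr (q : prime_idealr A) (x : A) : {subset p <= q} ->
  (repr (\pi_Ap x) \in q) = (x \in q).
Proof.
move=> pq.
have d : repr (\pi_Ap x) - x \in q by apply: pq; rewrite Quotient.idealrBE reprK.
apply/idP/idP => h; last by rewrite -(subrK x (repr _)) (@rpredD _ q).
by rewrite -[x](subKr (repr (\pi_Ap x))) (@rpredB _ q).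
Qed.

Lemma image_prime (q : prime_idealr A) : {subset p <= q} ->
  prime_ideal [set y : Ap | repr y \in q].
Proof.
move=> pq; have qE x := image_repr x pq.
split=> [||a b /=].
- split=> [|a u v /= qu qv]; first by rewrite /= -[0](rmorph0 (\pi_Ap)) qE idealr0.
  rewrite -[u]reprK -[v]reprK -[a]reprK /GRing.scale/= -rmorphM -rmorphD qE.
  by apply: (@rpredD _ q); rewrite ?idealMr.
- by rewrite /= -(rmorph1 (\pi_Ap)) qE idealr1.
by rewrite -[a]reprK -[b]reprK -rmorphM !qE prime_idealrM => /orP.
Qed.

End PrimesOfQuotient.

(** * Suprema of dimensions and chains of primes *)

Section Dimension.

Lemma dim_sup_ubound (S : set (\bar int)) d : S d -> (d <= dim_sup S)%E.
Proof. exact/ge_supremum_Nmem/ereal_int_supremums. Qed.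

(** The bound [-1 <= d] accounts for empty [S], whose supremum is the default value -1. *)
Lemma dim_sup_le (S : set (\bar int)) d :
  (-1 <= d)%E -> ubound S d -> (dim_sup S <= d)%E.
Proof.
move=> d1 Sd; rewrite /dim_sup /supremum; case: ifPn => // _.
have [e Se] := ereal_int_supremums S.
by case: xgetP => [_ -> [_]|/(_ e)//]; apply.
Qed.

Lemma dim_sup_geN1 (S : set (\bar int)) :
  (forall d, S d -> (-1 <= d)%E) -> (-1 <= dim_sup S)%E.
Proof.
move=> S1; have [->|/set0P[d Sd]] := eqVneq S set0.
  by rewrite /dim_sup supremum0.
exact: le_trans (S1 d Sd) (dim_sup_ubound Sd).
Qed.

Variable A : comNzRingType.

Lemma ring_dim_ge n : has_prime_chain A n -> (n%:Z%:E <= ring_dim A)%E.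
Proof. by move=> An; apply: dim_sup_ubound; exists n. Qed.

Lemma ring_dim_le d : (-1 <= d)%E ->
  (forall n, has_prime_chain A n -> (n%:Z%:E <= d)%E) -> (ring_dim A <= d)%E.
Proof. by move=> d1 Ad; apply: dim_sup_le => // _ [n /Ad ? <-]. Qed.

Lemma module_dim_geN1 (X : lmodType A) : (-1 <= module_dim X)%E.
Proof.
apply: dim_sup_geN1 => _ [p _ ->].
by apply: dim_sup_geN1 => _ [n _ <-]; rewrite lee_fin.
Qed.

Lemma has_prime_chainW k n : (k <= n)%N -> has_prime_chain A n -> has_prime_chain A k.
Proof. by move=> kn [p hp]; exists p => i ik; apply: hp; apply: leq_trans kn. Qed.

Lemma chain_subset (p : nat -> prime_idealr A) n i j :
    (forall i, (i < n)%N -> {subset p i <= p i.+1}) ->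
  (i <= j)%N -> (j <= n)%N -> {subset p i <= p j}.
Proof.
move=> hp /subnK <-; elim: (j - i)%N => [_ //|k IH] kn x.
by move=> /(IH (ltnW kn)); apply: hp.
Qed.

(** Dropping [p 0] and reducing the rest modulo [p 1] shortens the chain by one. *)
Lemma has_prime_chain_quot n (p : nat -> prime_idealr A) :
    (forall i, (i < n.+1)%N -> {subset p i <= p i.+1} /\ ~ {subset p i.+1 <= p i}) ->
  has_prime_chain {ideal_quot (p 1%N)} n.
Proof.
move=> hp.
(* The new chain needs a prime at every index, but [p] is controlled only up to [n.+1]; hence the
   truncation by [minn]. *)
have sub i : {subset p 1%N <= p (minn i n).+1}.
  apply: (@chain_subset p n.+1) => //; last by rewrite ltnS geq_minr.
  by move=> j /hp[].
exists (fun i => prime_of (image_prime (sub i))) => i ni.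
have [|s ns] := hp i.+1; first by rewrite ltnS.
have e1 : minn i n = i by apply/minn_idPl/ltnW.
have e2 : minn i.+1 n = i.+1 by apply/minn_idPl.
split=> [y /prime_ofP h|h].
  by apply/prime_ofP; move: h; rewrite /= e1 e2 => /s.
apply: ns => x px.
have /h/prime_ofP/= : \pi_({ideal_quot (p 1%N)}) x \in prime_of (image_prime (sub i.+1)).
  by apply/prime_ofP; rewrite /= (image_repr x (sub i.+1)) e2.
by rewrite (image_repr x (sub i)) e1.
Qed.

End Dimension.

(** * Chains of primes in a domain, and nonunits of a local one *)

Section DomainDimension.
Variable R : idomainType.

Lemma zero_prime_ideal : prime_ideal [set x : R | x = 0].
Proof.
split=> [||a b /eqP].
- split=> // a _ _ -> ->; exact: (etrans (addr0 _) (mulr0 a)).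
- exact/eqP/oner_neq0.
by rewrite mulf_eq0 => /orP[]/eqP; [left|right].
Qed.

Lemma has_prime_chain0 : has_prime_chain R 0.
Proof. by exists (fun=> prime_of zero_prime_ideal). Qed.

(** Pull the chain back to [R] and put the zero ideal below it; [c] makes the first inclusion
    strict. *)
Lemma has_prime_chainS n (p : prime_idealr R) c : c \in p -> c != 0 ->
  has_prime_chain {ideal_quot p} n -> has_prime_chain R n.+1.
Proof.
move=> pc c0 [q hq].
exists (fun i => if i is j.+1 then prime_of (preimage_prime (q j))
                 else prime_of zero_prime_ideal).
case=> [_|i]; first split=> [x /prime_ofP/= ->|].
- exact: idealr0.
- have qc : c \in prime_of (preimage_prime (q 0%N)).
    apply/prime_ofP => /=.
    by have /eqP-> : \pi_({ideal_quot p}) c == 0; rewrite ?ideal_quot_pi0 ?idealr0.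
  by move=> /(_ c qc)/prime_ofP/eqP; apply/negP.
rewrite ltnS => /hq[s ns]; split=> [x /prime_ofP/s ?|h]; first exact/prime_ofP.
apply: ns => y; rewrite -[y]reprK => qy.
by have /h/prime_ofP : repr y \in prime_of (preimage_prime (q i.+1)); first exact/prime_ofP.
Qed.

Lemma chain_nonzero (p q : prime_idealr R) : ~ {subset q <= p} ->
  exists2 c, c \in q & c != 0.
Proof.
move=> /existsNP[c /not_implyP[qc pc]]; exists c => //.
by apply/eqP => c0; apply: pc; rewrite c0 idealr0.
Qed.

Definition nonzero_primes_invertible : Prop :=
  forall (p : prime_idealr R) c, c \in p -> c != 0 -> invertible_mod p.

Lemma no_prime_chain2 : nonzero_primes_invertible -> ~ has_prime_chain R 2.
Proof.
move=> inv [p hp]; have [//|_ /chain_nonzero[c pc c0]] := hp 0%N.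
have [//|s /existsNP[b /not_implyP[p2b /negP p1b]]] := hp 1%N.
(* Both [1 - r b] and [b] lie in [p 2], which would then contain [1]. *)
have [r /s p2r] := inv _ _ pc c0 _ p1b.
by have := idealr1 (p 2); rewrite -(subrK (r * b) 1) (@rpredD _ (p 2)) ?idealMr.
Qed.

(** If [b] outside [p] is not invertible modulo [p], then [p + bR] is proper and lies in a prime
    [q], so 0, [p], [q] form a chain of length two. *)
Lemma primes_invertible_of_dim1 : noetherian_ring R -> ~ has_prime_chain R 2 ->
  nonzero_primes_invertible.
Proof.
move=> noeth no2 p c pc c0 b pb; apply: contrapT => /forallNP nr.
have pi := idealr_ideal p.
have [|q [qp addq _]] := noetherian_maximal_ideal noeth (ideal_addP b pi).
  by move=> [u pu [r e]]; apply: (nr r); rewrite e addrK.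
apply: no2; exists (fun i => match i with 0%N => prime_of zero_prime_ideal
                                        | 1%N => p | _ => prime_of qp end).
case=> [|[|//]] _; split=> [x|h].
- by move=> /prime_ofP/= ->; apply: idealr0.
- by have /prime_ofP/eqP := h c pc; apply/negP.
- by move=> px; apply/prime_ofP/addq; apply: ideal_add_sub.
by move/negP: pb; apply; apply: h; apply/prime_ofP/addq; apply: ideal_add_mem.
Qed.

Lemma nonfield_nonunit : ~ GRing.field_axiom R ->
  exists2 x : R, x != 0 & x \isn't a GRing.unit.
Proof.
by move=> /existsNP[x /not_implyP[x0 /negP xu]]; exists x.
Qed.

Lemma nonunit_principal_proper (x : R) : x \isn't a GRing.unit ->
  ~ [set u | exists r, u = r * x] 1.
Proof. by move=> /negP xu [r e]; apply: xu; apply/unitrPr; exists r; rewrite mulrC. Qed.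

Lemma has_prime_chain1 : noetherian_ring R -> ~ GRing.field_axiom R ->
  has_prime_chain R 1.
Proof.
move=> noeth /nonfield_nonunit[x x0 /nonunit_principal_proper xI].
have [M [Mp xM _]] := noetherian_maximal_ideal noeth (ideal_principal x) xI.
exists (fun i => if i is 0%N then prime_of zero_prime_ideal else prime_of Mp).
case=> // _; split=> [y /prime_ofP/= -> | h]; first exact: idealr0.
have /h/prime_ofP/eqP : x \in prime_of Mp.
  by apply/prime_ofP/xM; exists 1; rewrite mul1r.
by apply/negP.
Qed.

Lemma local_nonunit (m : idealr R) (x : R) : noetherian_ring R -> local_ring m ->
  x \isn't a GRing.unit -> x \in m.
Proof.
move=> noeth [_ locm] /nonunit_principal_proper xI.
have [M [[Mi M1 _] xM Mmax]] := noetherian_maximal_ideal noeth (ideal_principal x) xI.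
rewrite -(locm (idealr_of Mi M1)).
  by apply/asboolP/xM; exists 1; rewrite mul1r.
(* Maximality of [M] among sets that are proper ideals is carried over to [idealr], so that locality
   identifies [M] with [m]. *)
move=> J MJ y; have JE : [set z | z \in J] = M.
  apply: Mmax => [||z Mz]; first exact: idealr_ideal.
    by rewrite /= idealr1.
  by apply: MJ; apply/asboolP.
by apply/idP/asboolP; rewrite -JE.
Qed.

End DomainDimension.

(** * The module [Q(R)/R]: support, dimension and torsion *)

Lemma localized_eq0 (A : comNzRingType) (p : prime_idealr A) (X : lmodType A)
    (y : X) (s : denominator p) :
  \pi_(localized_module p X) (y, s) = 0 <-> exists2 u, u \notin p & u *: y = 0.
Proof.
have -> : 0 = \pi_(localized_module p X) (0, denominator1 p).
  by rewrite -[LHS]/(loc_zero p X) piE.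
split=> [/eqmodP/loc_equivP[[u pu]]|[u pu uy]].
  by rewrite /= mulr1 scaler0; exists u.
by apply/eqmodP/loc_equivP; exists (exist _ u pu); rewrite /= mulr1 uy scaler0.
Qed.

Section FractionQuotient.
Variable R : idomainType.
Local Notation "x %:F" := (@FracField.tofrac R x).

Definition frac_class (q : {fraction R}) : fraction_quotient R :=
  \pi_(Quotient.quot (subgroup
    (GRing.SubmodClosed.clone R (fraction_module R) (@base_submodule R) _))) q.

Lemma frac_classZ a q : a *: frac_class q = frac_class (a%:F * q).
Proof. exact: qscale_pi. Qed.

Lemma frac_classB q r : frac_class q - frac_class r = frac_class (q - r).
Proof. by rewrite /frac_class raddfB. Qed.

Lemma frac_class_eq0 q : frac_class q = 0 <-> exists a, q = a%:F.
Proof.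
rewrite -[0]pi_zeror; split=> [/eqP|h]; last apply/eqP.
  by rewrite -Quotient.idealrBE subr0 => /asboolP.
by rewrite -Quotient.idealrBE subr0; apply/asboolP.
Qed.

Lemma frac_class_surj y : exists q, y = frac_class q.
Proof. by exists (repr y); rewrite /frac_class reprK. Qed.

Lemma frac_numden (q : {fraction R}) : exists a b, b != 0 /\ q = a%:F / b%:F.
Proof.
elim/(@quotW _ {fraction R}): q => x.
exists \n_x, \d_x; have d0 := denom_ratioP x.
split=> //; apply: (canRL (mulfK _)); first by rewrite tofrac_eq0.
unlock FracField.tofrac; rewrite -[LHS]/(FracField.mul _ _) piE; apply/eqmodP => /=.
rewrite FracField.equivfE /FracField.mulf !numden_Ratio ?mulr1 ?oner_neq0//.
by rewrite mulrC.
Qed.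

Lemma frac_quotient_torsion y : exists2 b : R, b != 0 & b *: (y : fraction_quotient R) = 0.
Proof.
have [q ->] := frac_class_surj y; have [a [b [b0 ->]]] := frac_numden q.
exists b => //; rewrite frac_classZ; apply/frac_class_eq0; exists a.
by rewrite mulrC divfK ?tofrac_eq0.
Qed.

(** If [p] is zero, every denominator is outside [p] and kills the class it belongs to. If [c] is a
    nonzero element of [p], the class of [1/c] survives: [u/c] in [R] puts [u] in [cR], inside
    [p]. *)
Lemma support_frac_quotient (p : prime_idealr R) :
  module_support (fraction_quotient R) p <-> exists2 c, c \in p & c != 0.
Proof.
split=> [[f f0]|[c pc c0]].
  apply: contrapT => np; move/negP: f0; apply; apply/eqP.
  rewrite -[f]reprK; case: (repr f) => y s; apply/localized_eq0.
  have [b b0 by0] := frac_quotient_torsion y.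
  by exists b => //; apply/negP => pb; apply: np; exists b.
exists (\pi_(localized_module p (fraction_quotient R))
          (frac_class (c%:F)^-1, denominator1 p)).
apply/negP => /eqP/localized_eq0[u pu].
rewrite frac_classZ => /frac_class_eq0[a e].
have ec : u = a * c.
  by apply/eqP; rewrite -tofrac_eq tofracM -e divfK ?tofrac_eq0.
by move: pu; rewrite ec idealMr.
Qed.

Lemma module_dim_frac_quotient :
  module_dim (fraction_quotient R) = (ring_dim R - 1)%E.
Proof.
have ge0 := ring_dim_ge (has_prime_chain0 R).
apply/eqP; rewrite eq_le; apply/andP; split.
  apply: dim_sup_le => [|_ [p /support_frac_quotient[c pc c0] ->]].
    by move: ge0; case: (ring_dim R) => // d; rewrite !lee_fin; lia.
  apply: ring_dim_le => [|n /(has_prime_chainS pc c0)/ring_dim_ge].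
    by move: ge0; case: (ring_dim R) => // d; rewrite !lee_fin; lia.
  by case: (ring_dim R) => // d; rewrite !lee_fin; lia.
have M1 := module_dim_geN1 (fraction_quotient R).
(* Adding 1 on the right allows a bound chain by chain; infinite values are treated separately. *)
suff : (ring_dim R <= module_dim (fraction_quotient R) + 1)%E.
  move: M1 ge0; case: (module_dim _) => [e||]; case: (ring_dim R) => [d||] // _ _ h.
    by move: h; rewrite !lee_fin; lia.
  exact: leey.
(* A chain of length 0 needs only that the module has dimension at least -1. In a chain of length
   [n.+1], the prime [p 1] is nonzero, hence in the support, and its quotient has a chain of length
   [n]. *)
apply: ring_dim_le => [|[_|n [p hp]]].
- by move: M1; case: (module_dim _) => // d; rewrite !lee_fin; lia.
- by move: M1; case: (module_dim _) => // d; rewrite !lee_fin; lia.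
have [//|_ /chain_nonzero/support_frac_quotient sp] := hp 0%N.
have : (n%:Z%:E <= module_dim (fraction_quotient R))%E.
  apply: le_trans (ring_dim_ge (has_prime_chain_quot hp)) _.
  by apply: dim_sup_ubound; exists (p 1%N).
by case: (module_dim _) => // d; rewrite !lee_fin; lia.
Qed.

Lemma artinian_primes_invertible : artinian_module (fraction_quotient R) ->
  nonzero_primes_invertible R.
Proof.
move=> /artinian_dcc dccQ p c pc c0 b pb.
pose N n := [set y | exists r, y = r *: frac_class ((b ^+ n)%:F / c%:F)].
have [n|//|n _ [r ->]|n Nn] := dccQ N.
- split=> [|a _ _ [r ->] [s ->]]; first by exists 0; rewrite scale0r.
  by exists (a * r + s); rewrite scalerDl scalerA.
- by exists (r * b); rewrite -scalerA [b *: _]frac_classZ mulrA -tofracM -exprS.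
have [r] : N n.+1 (frac_class ((b ^+ n)%:F / c%:F)).
  by rewrite Nn//; exists 1; rewrite scale1r.
(* Clearing the denominator [c] yields [b^n - r b^(n+1) = t c], so [b^n (1 - r b)] is in [p] while
   [b] is not. *)
move/eqP; rewrite -subr_eq0 frac_classZ frac_classB => /eqP/frac_class_eq0[t].
move/(congr1 (fun z => z * c%:F)); rewrite mulrBl mulrA !divfK ?tofrac_eq0//.
rewrite -!tofracM -tofracB => /eqP; rewrite tofrac_eq => /eqP e.
exists r; have : b ^+ n * (1 - r * b) \in p.
  rewrite (_ : _ * _ = t * c) ?idealMr// -e exprS; ring.
rewrite prime_idealrM => /orP[|//].
elim: n {Nn e} => [|n IH]; first by rewrite idealr1.
by rewrite exprS prime_idealrM (negPf pb).
Qed.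

(** The map sending [r] to the class of [r/x] has kernel [xR] and image the [x]-torsion, so chains
    of torsion submodules pull back to chains of ideals above [xR]. *)
Lemma torsion_part_dcc (x : R) : x != 0 ->
  dcc (X := R^o) [set J | [set u | exists r, u = r * x] `<=` J] ->
  dcc [set N | N `<=` [set y : fraction_quotient R | x *: y = 0]].
Proof.
move=> x0 dccx N SN Nx dN.
have [i|i _ [r ->]|i r|n Nn] := dccx (fun i => [set r | N i (r *: frac_class (x%:F)^-1)]).
- split=> [|a u v Nu Nv]; first by rewrite /= scale0r; apply: (SN i).1.
  by rewrite /= scalerDl -scalerA; apply: (SN i).2.
- rewrite /= frac_classZ tofracM mulfK ?tofrac_eq0//.
  have -> : frac_class r%:F = 0 by apply/frac_class_eq0; exists r.
  exact: (SN i).1.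
- exact: dN.
have NE i j y : N j y -> (n <= i)%N -> (n <= j)%N -> N i y.
  move=> Ny ni nj; have := Nx _ _ Ny; have [q yq] := frac_class_surj y.
  rewrite /= yq frac_classZ => /frac_class_eq0[t e].
  (* Surjectivity onto the torsion: if [x q = t] is in [R], then [q = t/x]. *)
  have qE : frac_class q = t *: frac_class (x%:F)^-1.
    by rewrite frac_classZ -e mulrAC mulfV ?mul1r ?tofrac_eq0.
  have -> : N i (frac_class q) = [set r | N i (r *: frac_class (x%:F)^-1)] t.
    by rewrite qE.
  by rewrite Nn// -(Nn j)//= -qE -yq.
by exists n => i ni; apply/seteqP; split=> y Ny; apply: NE Ny _ _.
Qed.

End FractionQuotient.

(** * From maximality of nonzero primes to artinianity, and the theorem *)

Lemma artinian_of_dim1 (R : idomainType) (m : idealr R) :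
    local_ring m -> noetherian_ring R -> ~ GRing.field_axiom R ->
  nonzero_primes_invertible R -> artinian_module (fraction_quotient R).
Proof.
move=> loc noeth /nonfield_nonunit[x x0 xu] inv.
have dccR b : b != 0 -> dcc (X := R^o) [set J | [set u | exists r, u = r * b] `<=` J].
  move=> b0; apply: dcc_ideals_above => //; first exact: ideal_principal.
  by move=> p bp; apply: (inv p b) => //; apply: bp; exists 1; rewrite mul1r.
apply/artinian_dcc/(torsion_dcc (x := x)).
  exact/torsion_part_dcc/dccR.
move=> y; have [b b0 by0] := frac_quotient_torsion y.
pose xI := [set u | exists r, u = r * b].
(* The ideals [bR + x^n R] stabilise, which gives [x^n = s b + r x^(n+1)]. *)
have [i|i u|i _ [u [s ->] [r ->]]|n Nn] :=
    dccR b b0 (fun n => ideal_add xI (x ^+ n)).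
- exact/ideal_addP/ideal_principal.
- exact: ideal_add_sub.
- exists (s * b); first by exists s.
  by exists (r * x); rewrite exprS mulrA.
have : ideal_add xI (x ^+ n.+1) (x ^+ n).
  by rewrite Nn//; apply/ideal_add_mem/ideal_principal.
move=> [_ [s ->] [r e]]; exists n.
(* Here locality enters: [x] is in [m], so [1 - r x] is not. Dividing by it puts [x^n] in [bR],
   which kills [y]. *)
have u1 : 1 - r * x \is a GRing.unit.
  apply: contraT => /(local_nonunit noeth loc) m1.
  have xm := local_nonunit noeth loc xu.
  by have := idealr1 m; rewrite -(subrK (r * x) 1) (@rpredD _ m) ?idealMr.
rewrite (_ : x ^+ n = (s / (1 - r * x)) * b) -?scalerA ?by0 ?scaler0//.
rewrite mulrAC; apply: (canRL (mulrK u1)); apply/eqP; rewrite mulrBr mulr1.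
by rewrite {1}e exprS; apply/eqP; ring.
Qed.

(** Fields are excluded from the equivalence: there [Q(R)/R] is zero, hence artinian, while the
    dimension is 0. *)
Theorem proposition1p5 (R : idomainType) (m : idealr R)
    (Rlocal : local_ring m) (Rnoeth : noetherian_ring R) :
  module_dim (fraction_quotient R) = (ring_dim R - 1)%E /\
  (~ GRing.field_axiom R ->
     (artinian_module (fraction_quotient R) <-> ring_dim R = 1%E)).
Proof.
split=> [|nfield]; first exact: module_dim_frac_quotient.
split=> [/artinian_primes_invertible/no_prime_chain2 no2|dim1].
  apply/eqP; rewrite eq_le (ring_dim_ge (has_prime_chain1 Rnoeth nfield)) andbT.
  apply: ring_dim_le => // n Rn; rewrite lee_fin lez_nat leqNgt; apply/negP => n2.
  exact: no2 (has_prime_chainW n2 Rn).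
apply: (artinian_of_dim1 Rlocal Rnoeth nfield).
apply: (primes_invertible_of_dim1 Rnoeth) => R2.
by have := ring_dim_ge R2; rewrite dim1.
Qed.
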